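(* Let $m,n\in\mathbb{Z}$ with $\gcd(m,n)=1$, $mn(m+n)\ne0$, and $c=-\frac{A(m,n)}{B(m,n)}$. If $29\mid A(m,n)$ and either $7\nmid B(m,n)$ or $11\nmid B(m,n)$, then the only rational periodic cycle of $f_c(x)=x^2+c$ is its rational $3$-cycle (i.e. $f_c$ has no rational periodic points of minimal period other than $3$, and exactly one rational $3$-cycle).
   Context: $A(m,n)=m^6+2m^5n+4m^4n^2+8m^3n^3+9m^2n^4+4mn^5+n^6$, $B(m,n)=4m^2n^2(m+n)^2$. For such $(m,n)$, $f_c$ with $c=-A/B$ has a rational $3$-cycle (orbit of a rational point of minimal period $3$). *)

(* Defs.v *)
From mathcomp Require Import all_boot all_order all_algebra.
Set Implicit Arguments. Unset Strict Implicit. Unset Printing Implicit Defensive.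
Import Order.TTheory GRing.Theory Num.Theory.
Local Open Scope ring_scope.

Definition polyA (m n : int) : int :=
  m ^+ 6 + 2 * m ^+ 5 * n + 4 * m ^+ 4 * n ^+ 2 + 8 * m ^+ 3 * n ^+ 3
  + 9 * m ^+ 2 * n ^+ 4 + 4 * m * n ^+ 5 + n ^+ 6.

Definition polyB (m n : int) : int := 4 * m ^+ 2 * n ^+ 2 * (m + n) ^+ 2.

Definition fc (c x : rat) : rat := x ^+ 2 + c.

Definition min_period (c x : rat) (k : nat) : Prop :=
  (0 < k)%N /\ iter k (fc c) x = x /\
  (forall j : nat, (0 < j)%N -> (j < k)%N -> iter j (fc c) x <> x).

Definition in_cycle (c x0 : rat) (k : nat) (x : rat) : Prop :=
  exists j : nat, (j < k)%N /\ x = iter j (fc c) x0.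

(* Main.v *)
(**
Put P = m^3 - 3mn^2 - n^3, Q = mn(m+n), D = 2Q, so that B = D^2 and
A = P^2 + 2PQ + 8Q^2.  A rational periodic point is x = X/D with X an integer,
because otherwise the denominator of Dx grows along the orbit, and the orbit
satisfies D X_{i+1} = X_i^2 - A.

Periods divide 3 or are divisible by 4: modulo 29 the map is z -> z^2, every
periodic residue satisfies z^7 = 0 or 1 and has period 1 or 3, and if X_3 <> X_0,
multiplying D (X_{i+4} - X_{i+1}) = (X_{i+3} - X_i)(X_{i+3} + X_i) along the cycle
gives 2^(7k) = 1 modulo 29.

Periods k = 4q do not occur: the same telescoping with step 2q gives the product
of the X_i + X_{i+2q}, i < 2q, equal to - D^(2q).  At a prime p = 7 or 11 of good
reduction all cycles have length at most 3, the left-hand side is a square modulo p,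
and -1 is not.

Fixed points do not occur: y^2 = A + Q^2 is a model of X_1(18), whose Jacobian has a
rational 7-torsion point given by a difference of cusps; the corresponding function
S + Ty satisfies S^2 - T^2 y^2 = 4 (mn)^7 with coprime factors (S +- Ty)/2, so these
are seventh powers, which is false modulo 29 when 29 divides A.

A 3-cycle comes from t = x + f(x) = m'/n'.  Two of them with the same c have
Q' = Q after a change of sign, and A' = A leaves P' = P, which gives the same cycle, or
P' = -(P + 2Q).  In the second case (m - wn)(m' - wn') = M - wN (w^2 + w + 1 = 0) has
MN(M+N) = Q^2 with M, N coprime, so M, N and M + N are squares up to sign, which
is again false modulo 29.
*)
Require Import Defs.
From mathcomp Require Import all_boot all_order all_algebra.
From mathcomp Require Import ring zify.
Set Implicit Arguments.
Unset Strict Implicit.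
Import Order.TTheory GRing.Theory Num.Theory.
Local Open Scope ring_scope.

(** * Finite checks in prime fields; coprime integers and perfect powers *)

(** Turns a universal statement over ['F_p] into a test over the numerals below p that [vm_compute]
    can run. *)
Lemma Fp_all (p : nat) (P : pred 'F_p) : prime p ->
  all (fun i => P i%:R) (iota 0 p) -> forall x, P x.
Proof.
move=> pp /allP h x; rewrite -[x]natr_Zp; apply: h.
by rewrite mem_iota /= add0n -[X in (_ < X)%N](Fp_cast pp) ltn_ord.
Qed.

Lemma Fp_all2 (p : nat) (P : rel 'F_p) : prime p ->
  all (fun i => all (fun j => P i%:R j%:R) (iota 0 p)) (iota 0 p) ->
  forall x y, P x y.
Proof.
move=> pp h x; apply: Fp_all => //.
by apply: (@Fp_all p (fun x => all (fun j => P x j%:R) (iota 0 p))).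
Qed.

Lemma dvdz_Fp (p : nat) (a : int) : prime p ->
  (p%:Z %| a)%Z = (a%:~R == 0 :> 'F_p).
Proof. by move=> pp; rewrite (dvdz_pcharf (pchar_Fp pp)). Qed.

Lemma coprimez_prime (a b : int) :
  (forall p : nat, prime p ->
     a%:~R = 0 :> 'F_p -> b%:~R = 0 :> 'F_p -> False) ->
  coprimez a b.
Proof.
move=> h; rewrite coprimezE; apply/negPn/negP => nco.
have [p pp pg] : exists2 p, prime p & (p %| gcdn `|a| `|b|)%N.
  move: nco; rewrite /coprime; case: (gcdn _ _) => [|[|g]] // _.
    by exists 2%N.
  by exists (pdiv g.+2); rewrite ?pdiv_prime ?pdiv_dvd.
apply: (h _ pp); apply/eqP; rewrite -dvdz_Fp // dvdzE /=.
  exact: dvdn_trans pg (dvdn_gcdl _ _).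
exact: dvdn_trans pg (dvdn_gcdr _ _).
Qed.

Lemma coprimez_Fp (a b : int) (p : nat) : coprimez a b -> prime p ->
  a%:~R = 0 :> 'F_p -> b%:~R = 0 :> 'F_p -> False.
Proof.
move=> /coprimezP[[u v] /= e] pp a0 b0.
have := congr1 (fun x : int => x%:~R : 'F_p) e.
by rewrite rmorphD !rmorphM /= a0 b0 !mulr0 addr0 => /esym/eqP; rewrite oner_eq0.
Qed.

(** Put g = gcd(a, c), a = g a1 and c = g c1, so that a1 b = g^n c1^(n+1). Since a1 is coprime to c1
    and g to b, the numbers a1 and g^n divide each other. *)
Lemma coprime_expn_factor (n a b c : nat) : coprime a b ->
  (a * b = c ^ n.+1)%N -> exists u, a = (u ^ n.+1)%N.
Proof.
have [-> _ _|a0 co e] := posnP a; first by exists 0%N; rewrite exp0n.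
set g := gcdn a c; have g0 : (0 < g)%N by rewrite gcdn_gt0 a0.
have /dvdnP[a1 ea] : (g %| a)%N := dvdn_gcdl _ _.
have /dvdnP[c1 ec] : (g %| c)%N := dvdn_gcdr _ _.
have co1 : coprime a1 c1.
  by rewrite /coprime -(eqn_pmul2r g0) muln_gcdl -ea -ec mul1n.
have e1 : (a1 * b = g ^ n * c1 ^ n.+1)%N.
  apply/eqP; rewrite -(eqn_pmul2r g0) mulnAC -ea e ec expnMn.
  by rewrite [(g ^ n.+1)%N]expnSr mulnCA mulnA.
have a1g : (a1 %| g ^ n)%N.
  by rewrite -(Gauss_dvdl _ (coprimeXr n.+1 co1)) -e1 dvdn_mulr.
have ga1 : (g ^ n %| a1)%N.
  have cog : coprime (g ^ n) b by rewrite coprimeXl // (coprime_dvdl _ co) // ea dvdn_mull.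
  by rewrite -(Gauss_dvdl _ cog) e1 dvdn_mulr.
have {}ea1 : a1 = (g ^ n)%N by apply/eqP; rewrite eqn_dvd a1g.
by exists g; rewrite ea ea1 expnSr.
Qed.

Lemma coprimez_exp_factor (n : nat) (a b c : int) : coprimez a b ->
  a * b = c ^+ n.+1 -> exists (s : bool) u, a = (-1) ^+ s * u ^+ n.+1.
Proof.
move=> co e; have [|u ua] := @coprime_expn_factor n `|a| `|b| `|c| co.
  by rewrite -abszM e abszX.
exists (a < 0), u%:Z; rewrite {1}[a]intEsign; congr (_ * _).
by rewrite ua -[LHS]natz natrX natz.
Qed.

(** * The forms P and Q *)

(** With w a primitive cube root of unity, (m - w n)^3 = P - 3 w Q. The ring is arbitrary because
    the forms are evaluated in the integers, the rationals and ['F_p]. *)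
Definition cubP {R : comNzRingType} (m n : R) : R :=
  m ^+ 3 - 3 * m * n ^+ 2 - n ^+ 3.
Definition cubQ {R : comNzRingType} (m n : R) : R := m * n * (m + n).

Lemma polyAE (m n : int) :
  polyA m n = cubP m n ^+ 2 + 2 * cubP m n * cubQ m n + 8 * cubQ m n ^+ 2.
Proof. rewrite /polyA /cubP /cubQ; ring. Qed.

Lemma polyBE (m n : int) : polyB m n = (2 * cubQ m n) ^+ 2.
Proof. rewrite /polyB /cubQ; ring. Qed.

Lemma rmorph_cubP {R S : comNzRingType} (f : {rmorphism R -> S}) (m n : R) :
  f (cubP m n) = cubP (f m) (f n).
Proof. by rewrite /cubP !(rmorphXn, rmorph_nat, rmorphB, rmorphD, rmorphM) /=. Qed.

Lemma rmorph_cubQ {R S : comNzRingType} (f : {rmorphism R -> S}) (m n : R) :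
  f (cubQ m n) = cubQ (f m) (f n).
Proof. by rewrite /cubQ !(rmorphXn, rmorph_nat, rmorphB, rmorphD, rmorphM) /=. Qed.

(** * Exclusion of fixed points *)

(* S and T of the header: as a function of m/n, (S + Ty)/n^7 has divisor 7 (P0 - Poo), where
   P0 and Poo are points of y^2 = A + Q^2 over m/n = 0 and m/n = oo. *)
Definition sept_re {R : comNzRingType} (m n : R) : R :=
  m ^+ 7 + 2 * m ^+ 6 * n + 6 * m ^+ 5 * n ^+ 2 + 10 * m ^+ 4 * n ^+ 3
  + 12 * m ^+ 3 * n ^+ 4 + 10 * m ^+ 2 * n ^+ 5 + 4 * m * n ^+ 6 + n ^+ 7.
Definition sept_im {R : comNzRingType} (m n : R) : R :=
  m ^+ 4 + m ^+ 3 * n + 3 * m ^+ 2 * n ^+ 2 + 2 * m * n ^+ 3 + n ^+ 4.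

Lemma sept_norm (m n y : int) : y ^+ 2 = polyA m n + cubQ m n ^+ 2 ->
  (sept_re m n + sept_im m n * y) * (sept_re m n - sept_im m n * y)
  = 4 * (m * n) ^+ 7.
Proof.
move=> ey; transitivity (sept_re m n ^+ 2 - sept_im m n ^+ 2 * y ^+ 2); first ring.
rewrite ey /polyA /cubQ /sept_re /sept_im; ring.
Qed.

Lemma rmorph_sept_re {R S : comNzRingType} (f : {rmorphism R -> S}) (m n : R) :
  f (sept_re m n) = sept_re (f m) (f n).
Proof. by rewrite /sept_re !(rmorphXn, rmorph_nat, rmorphB, rmorphD, rmorphM) /=. Qed.

Lemma rmorph_sept_im {R S : comNzRingType} (f : {rmorphism R -> S}) (m n : R) :
  f (sept_im m n) = sept_im (f m) (f n).
Proof. by rewrite /sept_im !(rmorphXn, rmorph_nat, rmorphB, rmorphD, rmorphM) /=. Qed.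

(* [x ^+ 5 = 16 * x] expresses that x/2 is a seventh power or 0. *)
Lemma sept_F29 (m n : 'F_29) (s : bool) :
  cubP m n ^+ 2 + 2 * cubP m n * cubQ m n + 8 * cubQ m n ^+ 2 = 0 ->
  let x := sept_re m n + sept_im m n * ((-1) ^+ s * cubQ m n) in
  x ^+ 5 = 16 * x -> m = 0 /\ n = 0.
Proof.
have key (m0 n0 : 'F_29) :
  (if cubP m0 n0 ^+ 2 + 2 * cubP m0 n0 * cubQ m0 n0 + 8 * cubQ m0 n0 ^+ 2 == 0
   then all (fun s : bool =>
     let x := sept_re m0 n0 + sept_im m0 n0 * ((-1) ^+ s * cubQ m0 n0) in
     if x ^+ 5 == 16 * x then (m0 == 0) && (n0 == 0) else true)
     [:: true; false]
   else true).
  by move: m0 n0; apply: Fp_all2; [|vm_compute].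
move=> /eqP h1 x /eqP h2; have := key m n; rewrite h1 => /allP/(_ s).
move=> h; have sin : s \in [:: true; false] by case: (s).
have {h} : if x ^+ 5 == 16 * x then (m == 0) && (n == 0) else true := h sin.
by rewrite h2 => /andP[/eqP-> /eqP->].
Qed.

(** As 28 = 4 * 7, a seventh power modulo 29 is 0 or a fourth root of unity. *)
Lemma pow7_F29 (u : 'F_29) : (u ^+ 7) ^+ 5 = u ^+ 7.
Proof. by apply/eqP; move: u; apply: Fp_all; [|vm_compute]. Qed.

Lemma no_square_A_plus_Q2 (m n y : int) : coprimez m n ->
  (29 %| polyA m n)%Z -> y ^+ 2 = polyA m n + cubQ m n ^+ 2 -> False.
Proof.
move=> co dA ey; have nrm := sept_norm ey.
set S := sept_re m n in nrm; set T := sept_im m n in nrm.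
have [W eW] : exists W, S + T * y = 2 * W.
  suff /dvdzP[W eW] : (2 %| S + T * y)%Z by exists W; rewrite eW mulrC.
  have pr2 : prime 2 by [].
  rewrite (dvdz_Fp _ pr2); set x := _%:~R.
  (* The two factors of the norm agree modulo 2, and their product is even. *)
  have : x ^+ 2 = 0.
    rewrite /x -rmorphXn /=; apply/eqP; rewrite -(dvdz_Fp _ pr2).
    apply/dvdzP; exists (2 * (m * n) ^+ 7 + T * y * (S + T * y)).
    transitivity ((S + T * y) * (S - T * y) + 2 * (T * y) * (S + T * y)); first ring.
    rewrite nrm; ring.
  by move/eqP; rewrite expf_eq0.
have eWS : W * (S - W) = (m * n) ^+ 7.
  apply: (mulfI (_ : 4 != 0 :> int)) => //; rewrite -nrm eW.
  have -> : S - T * y = 2 * (S - W) by rewrite mulrBr -eW; ring.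
  ring.
(* A common prime divides both S and mn, but S is m^7 modulo n and n^7 modulo m. *)
have coW : coprimez W (S - W).
  apply: coprimez_prime => p pp W0 SW0.
  have S0 : sept_re (m%:~R : 'F_p) n%:~R = 0.
    by rewrite -rmorph_sept_re /= -/S -(subrK W S) rmorphD /= SW0 W0 addr0.
  have : (m%:~R * n%:~R : 'F_p) ^+ 7 = 0.
    by rewrite -intrM -rmorphXn /= -eWS intrM W0 mul0r.
  move/eqP; rewrite expf_eq0 /= mulf_eq0 => /orP[]/eqP z0; apply: (coprimez_Fp co pp) => //;
    apply/eqP; move: S0; rewrite /sept_re z0 !expr0n /= !(mulr0, mul0r, addr0, add0r) => /eqP;
    by rewrite expf_eq0.
have [s [u eu]] := coprimez_exp_factor coW eWS.
have pr29 : prime 29 by [].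
set M : 'F_29 := m%:~R; set N : 'F_29 := n%:~R; set Y : 'F_29 := y%:~R.
have A0 : cubP M N ^+ 2 + 2 * cubP M N * cubQ M N + 8 * cubQ M N ^+ 2 = 0.
  apply/eqP; move: dA; rewrite (dvdz_Fp _ pr29) polyAE.
  by rewrite !(rmorphXn, rmorph_nat, rmorph_cubP, rmorph_cubQ, rmorphD, rmorphM).
have [t et] : exists t : bool, Y = (-1) ^+ t * cubQ M N.
  have : Y ^+ 2 = cubQ M N ^+ 2.
    rewrite /Y -rmorphXn /= ey polyAE.
    rewrite !(rmorphXn, rmorph_nat, rmorph_cubP, rmorph_cubQ, rmorphD, rmorphM) /=.
    by rewrite A0 add0r.
  move/eqP; rewrite eqf_sqr => /orP[]/eqP->; first by exists false; rewrite mul1r.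
  by exists true; rewrite mulN1r.
have [] := @sept_F29 M N t A0; last by move=> *; apply: (coprimez_Fp co pr29).
rewrite -et.
have -> : sept_re M N + sept_im M N * Y = 2 * ((-1) ^+ s * (u%:~R : 'F_29) ^+ 7).
  rewrite /M /N /Y -rmorph_sept_re -rmorph_sept_im /= -intrM -intrD -/S -/T eW eu.
  by rewrite !(rmorphM, rmorphXn, rmorphN, rmorph1).
set v : 'F_29 := u%:~R.
have sg : ((-1) ^+ s : 'F_29) ^+ 5 = (-1) ^+ s.
  by rewrite -exprM -[LHS]signr_odd; case: (s).
(* Fifth powers fix signs and seventh powers, so only the factor 2 of S + Ty = 2W changes; it
   produces the 16. *)
have e32 : (2 : 'F_29) ^+ 5 = 16 * 2 by apply/eqP; vm_compute.
rewrite exprMn [(_ * v ^+ 7) ^+ 5]exprMn pow7_F29 sg e32.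
exact: esym (mulrA _ _ _).
Qed.

(** * Telescoping products and periodic orbits modulo 29 *)

(** Telescoping without division, so that some [d i] may vanish. Later [d i] is a difference of two
    orbit points and [s i] is their sum. *)
Lemma prod_of_ratios (R : comNzRingType) (D : R) (d s : nat -> R) :
  (forall i, D * d i.+1 = d i * s i) ->
  forall k, D ^+ k * d k = d 0%N * \prod_(i < k) s i.
Proof.
move=> h; elim=> [|k IH]; first by rewrite big_ord0 mul1r mulr1.
by rewrite big_ord_recr /= exprSr -mulrA h mulrA IH mulrA.
Qed.

Lemma periodic_mul (T : Type) (z : nat -> T) (k : nat) :
  (forall i, z (i + k)%N = z i) -> forall j i, z (i + j * k)%N = z i.
Proof.
move=> h; elim=> [|j IH] i; first by rewrite addn0.
by rewrite mulSn addnA IH h.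
Qed.

(** A periodic residue is a fourth power and, as 28 = 4 * 7, a nonzero fourth power is a seventh
    root of unity. *)
Lemma squaring_orbit_F29 (z : nat -> 'F_29) (k : nat) : (0 < k)%N ->
  (forall i, z i.+1 = z i ^+ 2) -> (forall i, z (i + k)%N = z i) ->
  forall i, (z i == 0) || (z i ^+ 7 == 1).
Proof.
move=> k0 zS zk i.
have key (u : 'F_29) : (u ^+ 4 == 0) || ((u ^+ 4) ^+ 7 == 1).
  by move: u; apply: Fp_all; [|vm_compute].
(* The index is two squarings short of two full periods after [i]. *)
suff -> : z i = z (i + 2 * k.-1)%N ^+ 4 by [].
rewrite -(periodic_mul zk 2) (_ : i + 2 * k = (i + 2 * k.-1).+2)%N; last lia.
by rewrite !zS -exprM.
Qed.

(** 12 is 2^7 modulo 29, and its order is 4. *)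
Lemma exp12_F29 (k : nat) : (12 : 'F_29) ^+ k = 1 -> (4 %| k)%N.
Proof.
have e4 : (12 : 'F_29) ^+ 4 = 1 by apply/eqP; vm_compute.
rewrite {1}(divn_eq k 4) exprD mulnC exprM e4 expr1n mul1r /dvdn.
have /allP key : all (fun r => ((12 : 'F_29) ^+ r == 1) ==> (r == 0)%N) (iota 0 4).
  by vm_compute.
move=> /eqP h; have := key (k %% 4)%N; rewrite h; apply.
by rewrite mem_iota ltn_mod.
Qed.

Lemma period3_or_dvd4 (A D : int) (X : nat -> int) (k : nat) : (0 < k)%N ->
  A%:~R = 0 :> 'F_29 -> D%:~R != 0 :> 'F_29 ->
  (forall i, D * X i.+1 = X i ^+ 2 - A) -> (forall i, X (i + k)%N = X i) ->
  X 3 = X 0%N \/ (4 %| k)%N.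
Proof.
move=> k0 A0 D0 XS Xk; have [|ne] := eqVneq (X 3) (X 0%N); [by left|right].
pose z i : 'F_29 := (X i)%:~R / D%:~R.
have zS i : z i.+1 = z i ^+ 2.
  apply: (mulfI D0); rewrite /z expr_div_n.
  have := congr1 (fun x : int => x%:~R : 'F_29) (XS i).
  rewrite rmorphM rmorphB rmorphXn /= A0 subr0 => e.
  by rewrite mulrA e; field.
have zk i : z (i + k)%N = z i by rewrite /z Xk.
have z7 := squaring_orbit_F29 k0 zS zk.
(* Three squarings raise to the eighth power, which fixes 0 and the seventh roots of unity. *)
have z3 i : z (i + 3)%N = z i.
  rewrite addnC /= !zS -!exprM; have /orP[/eqP->|/eqP e7] := z7 i; first by rewrite expr0n.
  by rewrite (exprD _ 7 1) e7 mul1r.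
pose d i := X (i + 3)%N - X i.
have dS i : D * d i.+1 = d i * (X i + X (i + 3)%N).
  by rewrite /d addSn mulrBr !XS; ring.
have dk : d k = d 0%N.
  by rewrite /d add0n (addnC k) Xk; congr (_ - _); rewrite -[in LHS](add0n k) Xk.
have d0 : d 0%N != 0 by rewrite /d subr_eq0 add0n.
have := prod_of_ratios dS k; rewrite dk mulrC => /(mulfI d0) e.
apply: exp12_F29.
have pk (a : 'F_29) : \prod_(i < k) a = a ^+ k by rewrite prodr_const card_ord.
have {e} e : 1 = \prod_(i < k) (2 * z i).
  have := congr1 (fun x : int => x%:~R / D%:~R ^+ k : 'F_29) e.
  rewrite rmorphXn /= divff ?expf_neq0 // => e1; rewrite {}[LHS]e1.
  rewrite rmorph_prod /= -exprVn -pk -big_split /=.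
  apply: eq_bigr => i _.
  by rewrite rmorphD mulrDl -/(z i) -/(z (i + 3)%N) z3 mulr_natl mulr2n.
(* The seventh power removes the [z i], none of which is 0 because the product is 1. *)
have := congr1 (fun x => x ^+ 7) e; rewrite /= expr1n -prodrXl => e'.
rewrite [RHS]e' -pk; apply: eq_bigr => i _.
have /orP[/eqP zi0|/eqP zi7] := z7 i.
  move/eqP: e; rewrite (bigD1 i) //= zi0 mulr0 mul0r.
  by rewrite oner_eq0.
have e27 : (2 : 'F_29) ^+ 7 = 12 by apply/eqP; vm_compute.
by rewrite exprMn zi7 mulr1 e27.
Qed.

(** * Periods divisible by 4, at a prime of good reduction *)

(* After 12 steps every orbit in F_7 or F_11 has entered its cycle; with e = (p + 1) / 4 the
   last test says that the argument is a square. *)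
Definition quad_orbit_check (p e : nat) (c : 'F_p) : bool :=
  let g x := x * x + c in
  all (fun u : nat => let z := iter 12 g u%:R in
    (iter 3 g z == z) ||
    ((g (g z) == z) && ((4 * z * g z) ^+ e * (4 * z * g z) ^+ e == 4 * z * g z)))
  (iota 0 p).

(** If the period of z divides 3, a shift by q equals a shift by 4q and fixes z, so the product is
    the square of its first half. If it divides 2, the product is (4 z_0 z_1)^q, and the check
    supplies a square root of 4 z_0 z_1. *)
Lemma quad_orbit_no4 (p e : nat) (c : 'F_p) (z : nat -> 'F_p) (q : nat) :
  prime p -> (forall x : 'F_p, x ^+ 2 != -1) -> quad_orbit_check e c ->
  (0 < q)%N -> (forall i, z i.+1 = z i ^+ 2 + c) ->
  (forall i, z (i + 4 * q)%N = z i) ->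
  \prod_(i < 2 * q) (z i + z (i + 2 * q)%N) = -1 -> False.
Proof.
move=> pp sq chk q0 zS z4 prd.
have sqF x : x ^+ 2 = -1 :> 'F_p -> False by move=> e'; have := sq x; rewrite e' eqxx.
pose g (x : 'F_p) := x * x + c.
have zg j i : z (i + j)%N = iter j g (z i).
  by elim: j => [|j IH]; rewrite ?addn0 // addnS zS IH iterS /g expr2.
have z0 i : z i = iter i g (z 0%N) by rewrite -zg add0n.
have key : (iter 3 g (z 0%N) == z 0%N) || ((g (g (z 0%N)) == z 0%N) &&
   ((4 * z 0%N * g (z 0%N)) ^+ e * (4 * z 0%N * g (z 0%N)) ^+ e
     == 4 * z 0%N * g (z 0%N))).
  (* Since q > 0, [3 * (4 * q)] is at least 12: the truncated subtraction is exact, and z_0 is a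
     twelfth iterate. *)
  have -> : z 0%N = iter 12 g (z (3 * (4 * q) - 12)%N).
    by rewrite -zg -(periodic_mul z4 3); congr z; lia.
  pose t := z (3 * (4 * q) - 12)%N; rewrite -/t.
  by move: t; apply: Fp_all.
have [/eqP z3|/andP[/eqP z2 /eqP zsq]] := orP key.
  have zi3 i : z (i + 3)%N = z i by rewrite zg z0 -iterD addnC iterD z3.
  have zq i : z (i + q)%N = z i.
    by rewrite -(periodic_mul zi3 q) (_ : _ + _ = i + 4 * q)%N //; lia.
  apply: (sqF (\prod_(i < q) (2 * z i))); rewrite -prd.
  have zq2 i : z (i + 2 * q)%N = z i by rewrite (periodic_mul zq).
  under [RHS]eq_bigr do rewrite zq2 -mulr2n -mulr_natl.
  rewrite mul2n -addnn big_split_ord /= expr2; congr (_ * _).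
  by apply: eq_bigr => i _; rewrite addnC zq.
have zi2 i : z (i + 2)%N = z i.
  by rewrite zg z0 -iterD addnC iterD [iter 2 _ _]z2.
apply: (sqF (((4 * z 0%N * g (z 0%N)) ^+ e) ^+ q)).
rewrite -prd expr2 -exprMn zsq.
have zq2 i : z (i + 2 * q)%N = z i by rewrite mulnC (periodic_mul zi2).
under eq_bigr do rewrite zq2 -mulr2n -mulr_natl.
elim: q {q0 z4 zq2 prd} => [|q IH]; first by rewrite big_ord0.
rewrite (_ : 2 * q.+1 = (2 * q).+2)%N; last lia.
rewrite !big_ord_recr /= -IH exprSr.
have zq0 : z (2 * q)%N = z 0%N by rewrite -[LHS]/(z (0 + _)%N) mulnC (periodic_mul zi2).
by rewrite zS zq0 /g expr2; ring.
Qed.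

(** Searching for c in B c = -A keeps the finite computation free of inverses in ['F_p]. *)
Lemma quad_orbit_checkF (p e : nat) : prime p ->
  all (fun i => all (fun j =>
    let m := i%:R : 'F_p in let n := j%:R : 'F_p in
    if 2 * cubQ m n == 0 then true else
    all (fun l => let c := l%:R : 'F_p in
      if (2 * cubQ m n) ^+ 2 * c ==
         - (cubP m n ^+ 2 + 2 * cubP m n * cubQ m n + 8 * cubQ m n ^+ 2)
      then quad_orbit_check e c else true) (iota 0 p)) (iota 0 p)) (iota 0 p) ->
  forall m n c : 'F_p, 2 * cubQ m n != 0 ->
    (2 * cubQ m n) ^+ 2 * c =
      - (cubP m n ^+ 2 + 2 * cubP m n * cubQ m n + 8 * cubQ m n ^+ 2) ->
    quad_orbit_check e c.
Proof.
move=> pp h m n c /negPf Q0 /eqP ec.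
have := Fp_all2 (P := fun m n : 'F_p => if 2 * cubQ m n == 0 then true else
    all (fun l => let c := l%:R : 'F_p in
      if (2 * cubQ m n) ^+ 2 * c ==
         - (cubP m n ^+ 2 + 2 * cubP m n * cubQ m n + 8 * cubQ m n ^+ 2)
      then quad_orbit_check e c else true) (iota 0 p)) pp h m n.
rewrite Q0 => {}h.
by have := Fp_all (P := fun c : 'F_p => if (2 * cubQ m n) ^+ 2 * c ==
         - (cubP m n ^+ 2 + 2 * cubP m n * cubQ m n + 8 * cubQ m n ^+ 2)
      then quad_orbit_check e c else true) pp h c; rewrite ec.
Qed.

Lemma quad_orbit_check7 (m n c : 'F_7) : 2 * cubQ m n != 0 ->
  (2 * cubQ m n) ^+ 2 * c =
    - (cubP m n ^+ 2 + 2 * cubP m n * cubQ m n + 8 * cubQ m n ^+ 2) ->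
  quad_orbit_check 2 c.
Proof. apply: quad_orbit_checkF; [by []|by vm_compute]. Qed.

Lemma quad_orbit_check11 (m n c : 'F_11) : 2 * cubQ m n != 0 ->
  (2 * cubQ m n) ^+ 2 * c =
    - (cubP m n ^+ 2 + 2 * cubP m n * cubQ m n + 8 * cubQ m n ^+ 2) ->
  quad_orbit_check 3 c.
Proof. apply: quad_orbit_checkF; [by []|by vm_compute]. Qed.

Lemma sqr_neqN1_F7 (x : 'F_7) : x ^+ 2 != -1.
Proof. by move: x; apply: Fp_all; [|vm_compute]. Qed.

Lemma sqr_neqN1_F11 (x : 'F_11) : x ^+ 2 != -1.
Proof. by move: x; apply: Fp_all; [|vm_compute]. Qed.

Lemma period_not_4 (p e : nat) (m n : int) (X : nat -> int) (q : nat) :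
  prime p -> (forall x : 'F_p, x ^+ 2 != -1) ->
  (forall m n c : 'F_p, 2 * cubQ m n != 0 ->
    (2 * cubQ m n) ^+ 2 * c =
      - (cubP m n ^+ 2 + 2 * cubP m n * cubQ m n + 8 * cubQ m n ^+ 2) ->
    quad_orbit_check e c) ->
  ~~ (p %| polyB m n)%Z -> (0 < q)%N ->
  (forall i, 2 * cubQ m n * X i.+1 = X i ^+ 2 - polyA m n) ->
  (forall i, X (i + 4 * q)%N = X i) -> X (2 * q)%N != X 0%N -> False.
Proof.
move=> pp sq chk nB q0; set D := 2 * cubQ m n => XS X4 ne.
have D0 : (D%:~R : 'F_p) != 0.
  by move: nB; rewrite dvdz_Fp // polyBE -/D rmorphXn expf_eq0.
pose c : 'F_p := - (polyA m n)%:~R / D%:~R ^+ 2.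
(* X is an orbit scaled by D; division by D modulo p gives back an orbit of z^2 + c. *)
pose z i : 'F_p := (X i)%:~R / D%:~R.
have DE : D%:~R = 2 * cubQ m%:~R n%:~R :> 'F_p.
  by rewrite rmorphM /= rmorph_cubQ rmorph_nat.
apply: (@quad_orbit_no4 p e c z q) => //.
- apply: (chk m%:~R n%:~R); rewrite -DE // /c mulrC divfK ?expf_neq0 //.
  by rewrite polyAE !(rmorphXn, rmorph_nat, rmorph_cubP, rmorph_cubQ, rmorphD, rmorphM).
- move=> i; apply: (mulfI D0).
  have := congr1 (fun x : int => x%:~R : 'F_p) (XS i).
  rewrite rmorphM rmorphB rmorphXn /= => e1.
  by rewrite /z mulrA e1 /c; field.
- by move=> i; rewrite /z X4.
pose d i := X (i + 2 * q)%N - X i.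
have dS i : D * d i.+1 = d i * (X i + X (i + 2 * q)%N).
  by rewrite /d addSn mulrBr !XS; ring.
(* Two shifts by [2 * q] make a multiple of the period, so one shift only changes the sign of the
   difference. *)
have dk : d (2 * q)%N = - d 0%N.
  rewrite /d add0n (_ : (2 * q + 2 * q)%N = 0 + 4 * q)%N; last lia.
  by rewrite X4 opprB.
have d0 : d 0%N != 0 by rewrite /d subr_eq0 add0n.
have := prod_of_ratios dS (2 * q); rewrite dk mulrN -mulNr mulrC => /(mulfI d0) e1.
have pk (a : 'F_p) : \prod_(i < 2 * q) a = a ^+ (2 * q) by rewrite prodr_const card_ord.
have := congr1 (fun x : int => x%:~R / D%:~R ^+ (2 * q) : 'F_p) e1.
rewrite rmorphN rmorphXn /= mulNr divff ?expf_neq0 // => ->.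
rewrite rmorph_prod /= -exprVn -pk -big_split /=.
by apply: eq_bigr => i _; rewrite rmorphD mulrDl.
Qed.

(** * Coprimality of A and B *)

Lemma intr_polyA (R : comNzRingType) (m n : int) :
  (polyA m n)%:~R = (cubP m n)%:~R ^+ 2 + 2 * (cubP m n)%:~R * (cubQ m n)%:~R
    + 8 * (cubQ m n)%:~R ^+ 2 :> R.
Proof.
rewrite polyAE; move: (cubP m n) (cubQ m n) => a b.
by rewrite !(rmorphXn, rmorph_nat, rmorphD, rmorphM).
Qed.

(** On each of the lines m = 0, n = 0 and m + n = 0 where Q vanishes, P is up to sign the cube of a
    coordinate. *)
Lemma cubP_cubQ_eq0 (F : fieldType) (m n : F) :
  cubP m n = 0 -> cubQ m n = 0 -> m = 0 /\ n = 0.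
Proof.
rewrite /cubP /cubQ => P0 /eqP; rewrite !mulf_eq0 -orbA => /or3P[] /eqP z0.
- move: P0; rewrite z0 expr0n /= mulr0 mul0r subr0 sub0r => /eqP.
  by rewrite oppr_eq0 expf_eq0 => /eqP.
- move: P0; rewrite z0 !expr0n /= mulr0 !subr0 => /eqP.
  by rewrite expf_eq0 => /eqP.
have en : n = - m by rewrite -(add0r (- m)) -z0; ring.
have : m ^+ 3 = 0.
  by move: P0; rewrite en => P0; rewrite -(oppr0 F) -P0; ring.
by move/eqP; rewrite expf_eq0 /= => /eqP m0; rewrite en m0 oppr0.
Qed.

Lemma coprimez_cubP_cubQ (m n : int) (p : nat) : coprimez m n -> prime p ->
  (cubP m n)%:~R = 0 :> 'F_p -> (cubQ m n)%:~R = 0 :> 'F_p -> False.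
Proof.
move=> co pp; rewrite rmorph_cubP rmorph_cubQ => P0 Q0.
by have [] := cubP_cubQ_eq0 P0 Q0; apply: coprimez_Fp.
Qed.

(** Since A = P^2 modulo 2Q, a common prime divides P. It cannot also divide Q, and P has no
    nontrivial zero modulo 2. *)
Lemma coprimez_polyA_polyB (m n : int) : coprimez m n ->
  coprimez (polyA m n) (polyB m n).
Proof.
move=> co; apply: coprimez_prime => p pp.
rewrite intr_polyA polyBE => A0 /eqP; rewrite rmorphXn expf_eq0 rmorphM /= mulf_eq0.
have nP : (cubP m n)%:~R = 0 :> 'F_p -> (cubQ m n)%:~R = 0 :> 'F_p -> False.
  exact: coprimez_cubP_cubQ.
have P0 : (2 * (cubQ m n)%:~R = 0 :> 'F_p) -> (cubP m n)%:~R = 0 :> 'F_p.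
  move=> Q0; apply/eqP; move/eqP: A0.
  rewrite (_ : _ + _ = (cubP m n)%:~R ^+ 2
      + (2 * (cubQ m n)%:~R) * ((cubP m n)%:~R + 4 * (cubQ m n)%:~R)); last by ring.
  by rewrite Q0 mul0r addr0 expf_eq0.
case/orP=> /eqP z0; last by apply: nP => //; apply: P0; rewrite z0 mulr0.
have {}z0 : 2 = 0 :> 'F_p by move: z0; rewrite rmorph_nat.
have {}P0 : (cubP m n)%:~R = 0 :> 'F_p by apply: P0; rewrite z0 mul0r.
have p2 : p = 2%N.
  have : (p %| 2)%N by rewrite (dvdn_pcharf (pchar_Fp pp)); apply/eqP.
  by rewrite dvdn_prime2 // => /eqP.
move: P0; rewrite rmorph_cubP; subst p.
have key (a b : 'F_2) : (cubP a b == 0) ==> (a == 0) && (b == 0).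
  by move: a b; apply: Fp_all2; [|vm_compute].
move=> /eqP P0; have := key m%:~R n%:~R; rewrite P0 => /andP[/eqP m0 /eqP n0].
exact: coprimez_Fp co pp m0 n0.
Qed.

(** * Pairs with the same A and Q *)

Lemma coprimez_addr (a b : int) : coprimez a b -> coprimez a (a + b).
Proof.
move=> co; apply: coprimez_prime => p pp a0; rewrite rmorphD /= a0 add0r.
exact: coprimez_Fp co pp a0.
Qed.

(* The product (m - w n)(m' - w n') in Z[w], w a primitive cube root of unity, is M - w N. *)
Lemma cubP_mul (R : comNzRingType) (m n m' n' : R) :
  cubP (m * m' - n * n') (m * n' + m' * n + n * n') =
  cubP m n * cubP m' n' - 9 * cubQ m n * cubQ m' n'.
Proof. rewrite /cubP /cubQ; ring. Qed.

Lemma cubQ_mul (R : comNzRingType) (m n m' n' : R) :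
  cubQ (m * m' - n * n') (m * n' + m' * n + n * n') =
  cubP m n * cubQ m' n' + cubP m' n' * cubQ m n + 3 * cubQ m n * cubQ m' n'.
Proof. rewrite /cubP /cubQ; ring. Qed.

(* [x ^+ 15 = x] expresses that x is a square; -1 is a square modulo 29. *)
Lemma cubP_cubQ_F29 (M N : 'F_29) :
  M ^+ 15 = M -> N ^+ 15 = N -> (M + N) ^+ 15 = M + N ->
  cubP M N + cubQ M N = 0 -> M = 0 /\ N = 0.
Proof.
have key (a b : 'F_29) :
    [&& a ^+ 15 == a, b ^+ 15 == b, (a + b) ^+ 15 == a + b & cubP a b + cubQ a b == 0]
    ==> (a == 0) && (b == 0).
  by move: a b; apply: Fp_all2; [|vm_compute].
move=> /eqP h1 /eqP h2 /eqP h3 /eqP h4.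
by have := key M N; rewrite h1 h2 h3 h4 => /andP[/eqP-> /eqP->].
Qed.

(** Here a is a square up to sign; the exponent 15 is odd, so it keeps the sign, and x^30 = x^2
    modulo 29. *)
Lemma signed_square_F29 (a b c : int) : coprimez a b -> a * b = c ^+ 2 ->
  (a%:~R : 'F_29) ^+ 15 = a%:~R.
Proof.
move=> co e; have [s [u ->]] := coprimez_exp_factor co e.
have key (x : 'F_29) : x ^+ 30 = x ^+ 2.
  by apply/eqP; move: x; apply: Fp_all; [|vm_compute].
rewrite rmorphM !rmorphXn rmorphN rmorph1 /= exprMn -!exprM key.
by congr (_ * _); rewrite -[LHS]signr_odd; case: (s).
Qed.

Lemma cubP_unique (m n m' n' : int) : coprimez m n -> (29 %| polyA m n)%Z ->
  cubQ m' n' = cubQ m n -> polyA m' n' = polyA m n ->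
  cubP m' n' = cubP m n.
Proof.
move=> co dA eQ eA.
have : (cubP m' n' - cubP m n) * (cubP m' n' + cubP m n + 2 * cubQ m n) = 0.
  have := eA; rewrite !polyAE eQ => /eqP; rewrite -subr_eq0 => /eqP <-; ring.
move/eqP; rewrite mulf_eq0 subr_eq0 => /orP[/eqP //|/eqP eP].
have {}eP : cubP m' n' = - (cubP m n + 2 * cubQ m n).
  by apply/eqP; rewrite -subr_eq0 -eP; apply/eqP; ring.
have [M [N [MP MQ]]] : exists M N : int,
    cubP M N = - (polyA m n + cubQ m n ^+ 2) /\ cubQ M N = cubQ m n ^+ 2.
  (* With P' = -(P + 2Q) and Q' = Q, the product formulas give PP' - 9Q^2 = -(A + Q^2) and PQ + P'Q
     + 3Q^2 = Q^2. *)
  exists (m * m' - n * n'), (m * n' + m' * n + n * n').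
  by rewrite cubP_mul cubQ_mul polyAE eP eQ; split; ring.
have pr29 : prime 29 by [].
have coMN : coprimez M N.
  (* Such a prime divides Q^2 and A + Q^2, hence Q and P. *)
  apply: coprimez_prime => p pp M0 N0.
  have Q0 : (cubQ m n)%:~R = 0 :> 'F_p.
    apply/eqP; have : (cubQ m n ^+ 2)%:~R = 0 :> 'F_p.
      by rewrite -MQ rmorph_cubQ /= M0 N0 /cubQ !mul0r.
    by move/eqP; rewrite rmorphXn expf_eq0.
  have P0 : (cubP m n)%:~R = 0 :> 'F_p.
    apply/eqP; have : (polyA m n + cubQ m n ^+ 2)%:~R = 0 :> 'F_p.
      by rewrite -[_ + _]opprK -MP rmorphN rmorph_cubP /= M0 N0 /cubP expr0n /= !(mulr0, mul0r, subr0, oppr0).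
    rewrite rmorphD rmorphXn /= intr_polyA Q0 !expr0n /= !mulr0 !addr0.
    by move/eqP; rewrite expf_eq0.
  exact: coprimez_cubP_cubQ co pp P0 Q0.
have coM : coprimez M (M + N) by apply: coprimez_addr.
have coN : coprimez N (M + N) by rewrite addrC coprimez_addr // coprimez_sym.
have [] := @cubP_cubQ_F29 M%:~R N%:~R.
- by apply: (@signed_square_F29 M (N * (M + N)) (cubQ m n)); rewrite ?coprimezMr ?coMN // -MQ /cubQ mulrA.
- apply: (@signed_square_F29 N (M * (M + N)) (cubQ m n)).
    by rewrite coprimezMr coprimez_sym coMN.
  by rewrite -MQ /cubQ; ring.
- rewrite -rmorphD; apply: (@signed_square_F29 (M + N) (M * N) (cubQ m n)).
    by rewrite coprimezMr ![coprimez (M + N) _]coprimez_sym coM.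
  by rewrite -MQ /cubQ mulrC.
(* At (M, N) the sum P + Q is -A, which vanishes modulo 29. *)
- rewrite -rmorph_cubP -rmorph_cubQ -rmorphD MP MQ opprD subrK rmorphN /=.
  by apply/eqP; rewrite oppr_eq0 -(dvdz_Fp _ pr29).
- by move=> M0 N0; case: (coprimez_Fp coMN pr29 M0 N0).
Qed.

(** * The parameter of a 3-cycle *)

(** The three differences along the cycle x, y, w add up to 0; divided by y - x this reads 1 + t + t
    (y + w) = 0. As y = t - x and w = y + (y - x) t, it is linear in x, so x and then c are
    functions of t. *)
Lemma cycle3_param (c x t : rat) : t = x + fc c x ->
  iter 3 (fc c) x = x -> fc c x != x ->
  [/\ t * (t + 1) != 0,
      2 * (t * (t + 1)) * x = t ^+ 3 + 2 * t ^+ 2 + t + 1 &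
      4 * (t * (t + 1)) ^+ 2 * c =
        - (t ^+ 6 + 2 * t ^+ 5 + 4 * t ^+ 4 + 8 * t ^+ 3 + 9 * t ^+ 2 + 4 * t + 1)].
Proof.
rewrite /=; set y := fc c x; set w := fc c y => et ew nyx.
have eyx : w - y = (y - x) * t by rewrite et /w /fc /y /fc; ring.
have exw : x - w = (w - y) * (y + w) by rewrite -[in LHS]ew /w /fc; ring.
have d0 : y - x != 0 by rewrite subr_eq0.
have rel : 1 + t + t * (y + w) = 0.
  apply: (mulfI d0); rewrite mulr0.
  transitivity ((y - x) + (w - y) + (x - w)); last by ring.
  by rewrite exw eyx; ring.
have wE : w = y + (y - x) * t by rewrite -eyx; ring.
have yE : y = t - x by rewrite et; ring.
have rel2 : 2 * (t * (t + 1)) * x = t ^+ 3 + 2 * t ^+ 2 + t + 1.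
  apply/eqP; rewrite -subr_eq0; apply/eqP.
  by rewrite -[RHS]oppr0 -rel wE yE; ring.
have t0 : t != 0.
  by apply: contra_eq_neq rel => ->; rewrite mul0r !addr0 oner_eq0.
have t1 : t + 1 != 0.
  apply: contra_eq_neq rel2 => e; rewrite e mulr0 mulr0 mul0r eq_sym.
  by rewrite (_ : t = -1) //; apply/eqP; rewrite -subr_eq0 opprK e.
have tt : t * (t + 1) != 0 by rewrite mulf_neq0.
split=> //.
have cE : c = t - x - x ^+ 2 by rewrite et /y /fc; ring.
have xE : x = (t ^+ 3 + 2 * t ^+ 2 + t + 1) / (2 * (t * (t + 1))).
  by rewrite -rel2 mulrC mulKf // mulf_neq0.
by rewrite cE xE; field; rewrite t0 t1.
Qed.

(** * Integrality of scaled periodic points *)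

(** With z = a/b, clearing denominators leaves b^2 against the factor a^2 - A b^2, to which it is
    coprime. *)
Lemma sqr_denq_dvd (A D : int) (z w : rat) : D%:~R * w = z ^+ 2 - A%:~R ->
  (denq z ^+ 2 %| denq w)%Z.
Proof.
move=> e.
have e' : D * numq w * denq z ^+ 2 = denq w * (numq z ^+ 2 - A * denq z ^+ 2).
  apply: (@intr_inj rat); rewrite !(rmorphXn, rmorphB, rmorphM) /=.
  have z0 : (denq z)%:~R != 0 :> rat by rewrite intr_eq0 denq_neq0.
  have w0 : (denq w)%:~R != 0 :> rat by rewrite intr_eq0 denq_neq0.
  move: e; rewrite -{1}(divq_num_den w) -{1}(divq_num_den z).
  move: (numq z)%:~R (denq z)%:~R (numq w)%:~R (denq w)%:~R z0 w0 => a b a' b' b0 b'0 e.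
  transitivity (D%:~R * (a' / b') * (b' * b ^+ 2)); first by field.
  by rewrite e; field.
have co : coprimez (denq z ^+ 2) (numq z ^+ 2 - A * denq z ^+ 2).
  apply: coprimez_prime => p pp; rewrite rmorphXn => /eqP; rewrite expf_eq0 => /eqP b0.
  rewrite rmorphB !(rmorphXn, rmorphM) /= b0 expr0n /= mulr0 subr0 => /eqP.
  rewrite expf_eq0 /= => /eqP a0.
  by apply: (coprimez_Fp _ pp a0 b0); rewrite coprimezE coprime_num_den.
by rewrite -(Gauss_dvdzl _ co) -e' dvdz_mull.
Qed.

Lemma fc_scale (m n : int) (x c : rat) :
  (polyB m n)%:~R * c = - (polyA m n)%:~R ->
  (2 * cubQ m n)%:~R * ((2 * cubQ m n)%:~R * fc c x) =
    ((2 * cubQ m n)%:~R * x) ^+ 2 - (polyA m n)%:~R.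
Proof.
rewrite polyBE rmorphXn /fc /= => e.
by rewrite -e; ring.
Qed.

Lemma periodic_scaled_int (m n : int) (c x : rat) (k : nat) : (0 < k)%N ->
  (polyB m n)%:~R * c = - (polyA m n)%:~R -> iter k (fc c) x = x ->
  exists X : int, (2 * cubQ m n)%:~R * x = X%:~R.
Proof.
move=> k0 ec ek; pose z i := (2 * cubQ m n)%:~R * iter i (fc c) x.
have zS i : (denq (z i) ^+ 2 %| denq (z i.+1))%Z.
  by apply: (@sqr_denq_dvd (polyA m n) (2 * cubQ m n)); apply: fc_scale.
have le2 i : denq (z i) ^+ 2 <= denq (z i.+1).
  have := zS i; have := denq_gt0 (z i.+1); move: (denq _ ^+ 2) (denq _) => a b b0.
  rewrite dvdzE => /dvdn_leq; lia.
have d1 i : 1 <= denq (z i) by rewrite -gtz0_ge1 denq_gt0.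
have mono i j : (i <= j)%N -> denq (z i) <= denq (z j).
  move=> /subnK <-; elim: (j - i)%N => [|l IH] //; apply: le_trans IH _.
  by apply: le_trans (le2 _); rewrite expr2 ler_peMr // (le_trans ler01).
(* The denominators satisfy d_0^2 <= d_1 <= d_k = d_0, which forces d_0 = 1. *)
have : denq (z 0%N) ^+ 2 <= denq (z 0%N).
  apply: le_trans (le2 0%N) _; apply: le_trans (mono _ _ k0) _.
  by rewrite /z ek.
have := d1 0%N; rewrite -[X in denq X]/(_ * x) => d_ge1 d_le.
exists (numq ((2 * cubQ m n)%:~R * x)).
rewrite -[LHS]divq_num_den; suff -> : denq ((2 * cubQ m n)%:~R * x) = 1 by rewrite divr1.
move: d_ge1 d_le; rewrite /z /=; set b := denq _; nia.
Qed.

(** * The explicit 3-cycle and its uniqueness *)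

Lemma ratr_polyA (m n : int) :
  (polyA m n)%:~R = m%:~R ^+ 6 + 2 * m%:~R ^+ 5 * n%:~R + 4 * m%:~R ^+ 4 * n%:~R ^+ 2
    + 8 * m%:~R ^+ 3 * n%:~R ^+ 3 + 9 * m%:~R ^+ 2 * n%:~R ^+ 4
    + 4 * m%:~R * n%:~R ^+ 5 + n%:~R ^+ 6 :> rat.
Proof. by rewrite /polyA !(rmorphXn, rmorph_nat, rmorphD, rmorphM). Qed.

Lemma ratr_polyB (m n : int) :
  (polyB m n)%:~R = 4 * cubQ m%:~R n%:~R ^+ 2 :> rat.
Proof.
rewrite polyBE -rmorph_cubQ; move: (cubQ m n) => q.
by rewrite !(rmorphXn, rmorph_nat, rmorphM) exprMn /=; ring.
Qed.

(** [x1] is the x of [cycle3_param] at t = a/b, made homogeneous, and [x2] is a/b - [x1]. *)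
Lemma fc_cycle (m n : int) (c : rat) : cubQ m n != 0 ->
  (polyB m n)%:~R * c = - (polyA m n)%:~R ->
  let a : rat := m%:~R in let b : rat := n%:~R in
  let x1 := (a ^+ 3 + 2 * a ^+ 2 * b + a * b ^+ 2 + b ^+ 3) / (2 * cubQ a b) in
  let x2 := (a ^+ 3 - a * b ^+ 2 - b ^+ 3) / (2 * cubQ a b) in
  let x3 := - (a ^+ 3 + 2 * a ^+ 2 * b + 3 * a * b ^+ 2 + b ^+ 3) / (2 * cubQ a b) in
  [/\ fc c x1 = x2, fc c x2 = x3 & fc c x3 = x1].
Proof.
move=> Q0; rewrite ratr_polyA ratr_polyB; move: Q0.
rewrite -(intr_eq0 rat) rmorph_cubQ /=.
move: (m%:~R : rat) (n%:~R : rat) => a b; rewrite /cubQ => Q0 ec.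
have : [&& a != 0, b != 0 & a + b != 0] by move: Q0; rewrite !mulf_eq0 !negb_or -andbA.
case/and3P=> a0 b0 ab0.
have -> : c = - (a ^+ 6 + 2 * a ^+ 5 * b + 4 * a ^+ 4 * b ^+ 2
    + 8 * a ^+ 3 * b ^+ 3 + 9 * a ^+ 2 * b ^+ 4
    + 4 * a * b ^+ 5 + b ^+ 6) / (4 * (a * b * (a + b)) ^+ 2).
  by rewrite -ec mulrC mulKf // mulf_neq0 // expf_neq0.
by rewrite /fc; split; field; rewrite a0 b0 ab0.
Qed.

(** Write t = m'/n' in lowest terms. Then A/B and A'/B' are both reduced forms of -c, so A' = A, B'
    = B and Q' = Q up to sign; negating m' and n' corrects the sign and keeps A'. *)
Lemma cycle3_int_param (m n : int) (c x : rat) : coprimez m n -> cubQ m n != 0 ->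
  (polyB m n)%:~R * c = - (polyA m n)%:~R ->
  iter 3 (fc c) x = x -> fc c x != x ->
  exists m' n' : int, [/\ cubQ m' n' = cubQ m n, polyA m' n' = polyA m n &
    2 * cubQ m'%:~R n'%:~R * x = m'%:~R ^+ 3 + 2 * m'%:~R ^+ 2 * n'%:~R
      + m'%:~R * n'%:~R ^+ 2 + n'%:~R ^+ 3].
Proof.
move=> co Q0 ec e3 e1; set t := x + fc c x.
have [t0 xE cE] := cycle3_param (erefl t) e3 e1.
have co' : coprimez (numq t) (denq t) by rewrite coprimezE coprime_num_den.
have b0 : (denq t)%:~R != 0 :> rat by rewrite intr_eq0 denq_neq0.
have tE := divq_num_den t.
set m' := numq t in tE co'; set n' := denq t in tE co' b0.
have ec' : (polyB m' n')%:~R * c = - (polyA m' n')%:~R.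
  rewrite ratr_polyA ratr_polyB.
  move: cE; rewrite -tE /cubQ; move: (m'%:~R) (n'%:~R) b0 => a b b0 cE.
  have -> : 4 * (a * b * (a + b)) ^+ 2 * c
          = (4 * (a / b * (a / b + 1)) ^+ 2 * c) * b ^+ 6 by field.
  by rewrite cE; field.
have xE' : 2 * cubQ m'%:~R n'%:~R * x = m'%:~R ^+ 3 + 2 * m'%:~R ^+ 2 * n'%:~R
      + m'%:~R * n'%:~R ^+ 2 + n'%:~R ^+ 3.
  move: xE; rewrite -tE /cubQ; move: (m'%:~R) (n'%:~R) b0 => a b b0 xE.
  have -> : 2 * (a * b * (a + b)) * x = (2 * (a / b * (a / b + 1)) * x) * b ^+ 3 by field.
  by rewrite xE; field.
have eAB : polyA m n * polyB m' n' = polyA m' n' * polyB m n.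
  apply: (@intr_inj rat); rewrite [LHS]intrM [RHS]intrM.
  have nA : (polyA m n)%:~R = - ((polyB m n)%:~R * c) by rewrite ec opprK.
  have nA' : (polyA m' n')%:~R = - ((polyB m' n')%:~R * c) by rewrite ec' opprK.
  by rewrite nA nA'; ring.
have B0 : 0 < polyB m n by rewrite polyBE exprn_even_gt0 //= mulf_neq0.
have coAB := coprimez_polyA_polyB co; have coAB' := coprimez_polyA_polyB co'.
have dB : (polyB m n %| polyB m' n')%Z.
  have : (polyB m n %| polyA m n * polyB m' n')%Z by rewrite eAB dvdz_mull.
  by rewrite Gauss_dvdzr // coprimez_sym.
have dB' : (polyB m' n' %| polyB m n)%Z.
  have : (polyB m' n' %| polyA m' n' * polyB m n)%Z by rewrite -eAB dvdz_mull.
  by rewrite Gauss_dvdzr // coprimez_sym.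
have B0' : 0 <= polyB m' n' by rewrite polyBE exprn_even_ge0.
have eB : polyB m' n' = polyB m n.
  have : (`|polyB m' n'| == `|polyB m n|)%N by rewrite eqn_dvd -!dvdzE dB' dB.
  by move: B0 B0'; move: (polyB m n) (polyB m' n') => u v; lia.
have eA : polyA m' n' = polyA m n.
  by apply: (mulIf (lt0r_neq0 B0)); rewrite -eAB eB.
have : cubQ m' n' ^+ 2 = cubQ m n ^+ 2.
  by apply: (mulfI (_ : 4 != 0 :> int)) => //; move: eB; rewrite !polyBE !exprMn.
move/eqP; rewrite eqf_sqr => /orP[]/eqP eQ; first by exists m', n'.
exists (- m'), (- n'); split.
- by rewrite -[RHS]opprK -eQ /cubQ; ring.
- by rewrite -eA /polyA; ring.
- rewrite !rmorphN /=; apply: oppr_inj; move: xE'; rewrite /cubQ => xE'.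
  by transitivity (2 * (m'%:~R * n'%:~R * (m'%:~R + n'%:~R)) * x); [ring|rewrite xE'; ring].
Qed.

(** With t = m/n, the factors vanish when m'/n' is t, -1/(t + 1) or -(t + 1)/t: the orbit of t under
    a map of order 3, which permutes the parameters of the points of one cycle. *)
Lemma cubP_cubQ_cross (R : comNzRingType) (m n m' n' : R) :
  cubP m n * cubQ m' n' - cubP m' n' * cubQ m n =
  (m * n' - m' * n) * (m' * (m + n) + n * n') * (m' * m + n' * (m + n)).
Proof. rewrite /cubP /cubQ; ring. Qed.

Lemma unique_cycle3 (m n : int) (c x : rat) : coprimez m n -> cubQ m n != 0 ->
  (29 %| polyA m n)%Z -> (polyB m n)%:~R * c = - (polyA m n)%:~R ->
  iter 3 (fc c) x = x -> fc c x != x ->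
  in_cycle c ((m%:~R ^+ 3 + 2 * m%:~R ^+ 2 * n%:~R + m%:~R * n%:~R ^+ 2 + n%:~R ^+ 3)
    / (2 * cubQ m%:~R n%:~R)) 3 x.
Proof.
move=> co Q0 dA ec e3 e1.
have [m' [n' [eQ eA xE]]] := cycle3_int_param co Q0 ec e3 e1.
have eP := cubP_unique co dA eQ eA.
have [f1 f2 _] := fc_cycle Q0 ec.
have Q0' : cubQ m' n' != 0 by rewrite eQ.
have : cubP m n * cubQ m' n' - cubP m' n' * cubQ m n = 0 by rewrite eP eQ subrr.
move/(congr1 (fun z : int => z%:~R : rat)); rewrite cubP_cubQ_cross.
rewrite !(rmorphM, rmorphB, rmorphD) /=.
move: Q0 Q0' f1 f2 xE; rewrite -!(intr_eq0 rat) !rmorph_cubQ /=.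
move: (m%:~R : rat) (n%:~R : rat) (m'%:~R : rat) (n'%:~R : rat) => a b a' b'.
rewrite /cubQ => Q0 Q0' f1 f2 xE.
have : [&& a != 0, b != 0 & a + b != 0] by move: Q0; rewrite !mulf_eq0 !negb_or -andbA.
case/and3P=> a0 b0 ab0.
have b0' : b' != 0 by apply: contraNneq Q0' => ->; rewrite mulr0 mul0r.
have {}xE : x = (a' ^+ 3 + 2 * a' ^+ 2 * b' + a' * b' ^+ 2 + b' ^+ 3)
    / (2 * (a' * b' * (a' + b'))).
  by rewrite -xE mulrC mulKf // mulf_neq0.
(* The three factors correspond in this order to the first, third and second points of the cycle. *)
move/eqP; rewrite !mulf_eq0 -orbA => /or3P[] /eqP e0.
- have a'E : a' = a * b' / b.
    by apply: (mulIf b0); rewrite divfK //; apply/eqP; rewrite eq_sym -subr_eq0 e0.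
  exists 0%N; split=> //=; rewrite xE a'E; field.
  by rewrite a0 b0 ab0 b0' mulrC -mulrDr mulf_neq0.
- have a'E : a' = - (b * b') / (a + b).
    by apply: (mulIf ab0); rewrite divfK //; apply/eqP; rewrite -subr_eq0 opprK e0.
  exists 2%N; split=> //=; rewrite f1 f2 xE a'E; field.
  by rewrite a0 b0 ab0 b0' (_ : _ + _ = a * b') ?mulf_neq0 //; ring.
have a'E : a' = - (b' * (a + b)) / a.
  by apply: (mulIf a0); rewrite divfK //; apply/eqP; rewrite -subr_eq0 opprK e0.
exists 1%N; split=> //=; rewrite f1 xE a'E; field.
by rewrite a0 b0 ab0 b0' (_ : _ + _ = - (b' * b)) ?oppr_eq0 ?mulf_neq0 //; ring.
Qed.

(** Up to a nonzero constant, the numerators of x2 - x1 and x3 - x1 are b and a + b times the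
    positive definite form a^2 + ab + b^2. *)
Lemma min_period3_start (m n : int) (c : rat) : cubQ m n != 0 ->
  (polyB m n)%:~R * c = - (polyA m n)%:~R ->
  min_period c ((m%:~R ^+ 3 + 2 * m%:~R ^+ 2 * n%:~R + m%:~R * n%:~R ^+ 2 + n%:~R ^+ 3)
    / (2 * cubQ m%:~R n%:~R)) 3.
Proof.
move=> Q0 ec; have [f1 f2 f3] := fc_cycle Q0 ec.
split=> //; split; first by rewrite /= f1 f2 f3.
have : [&& m != 0, n != 0 & m + n != 0] by move: Q0; rewrite !mulf_eq0 !negb_or -andbA.
rewrite -!(intr_eq0 rat) rmorphD /=.
move: (m%:~R : rat) (n%:~R : rat) f1 f2 => a b f1 f2 /and3P[a0 b0 ab0].
have D0 : (2 * cubQ a b) != 0 by rewrite !mulf_neq0.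
have N0 : a ^+ 2 + a * b + b ^+ 2 != 0.
  have : 0 < (2 * a + b) ^+ 2 + 3 * b ^+ 2.
    apply: ltr_wpDl; first exact: sqr_ge0.
    by apply: mulr_gt0; [exact: ltr0Sn|rewrite exprn_even_gt0].
  apply: contraTneq => N0; rewrite (_ : _ + _ = 4 * (a ^+ 2 + a * b + b ^+ 2)); last by ring.
  by rewrite N0 mulr0 ltxx.
case=> [|[|[|j]]] // _ _; rewrite /= ?f1 ?f2 => /(congr1 ( *%R^~ (2 * cubQ a b))) /=;
  rewrite !divfK // => /eqP; rewrite -subr_eq0.
- rewrite (_ : _ - _ = - (2 * b * (a ^+ 2 + a * b + b ^+ 2))); last by ring.
  by rewrite oppr_eq0 !mulf_eq0 (negPf b0) (negPf N0).
- rewrite (_ : _ - _ = - (2 * (a + b) * (a ^+ 2 + a * b + b ^+ 2))); last by ring.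
  by rewrite oppr_eq0 !mulf_eq0 (negPf ab0) (negPf N0).
Qed.

(** * All periods equal 3, and the final assembly *)

Lemma min_period_eq3 (m n : int) (c x : rat) (k : nat) : coprimez m n ->
  cubQ m n != 0 -> (29 %| polyA m n)%Z ->
  ~~ (7 %| polyB m n)%Z \/ ~~ (11 %| polyB m n)%Z ->
  (polyB m n)%:~R * c = - (polyA m n)%:~R ->
  min_period c x k -> k = 3%N.
Proof.
move=> co Q0 dA nB ec [k0 [ek mk]]; set D := 2 * cubQ m n.
have D0 : D != 0 by rewrite mulf_neq0.
have D0R : D%:~R != 0 :> rat by rewrite intr_eq0.
have ek_i i : iter k (fc c) (iter i (fc c) x) = iter i (fc c) x.
  by rewrite -iterD addnC iterD ek.
pose X i := numq (D%:~R * iter i (fc c) x).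
have XE i : (X i)%:~R = D%:~R * iter i (fc c) x.
  by have [z] := periodic_scaled_int k0 ec (ek_i i); rewrite /X -/D => ->; rewrite numq_int.
have X_inj i : X i = X 0%N -> iter i (fc c) x = x.
  by move=> /(congr1 (fun z : int => z%:~R : rat)); rewrite !XE => /(mulfI D0R).
have XS i : D * X i.+1 = X i ^+ 2 - polyA m n.
  apply: (@intr_inj rat); rewrite intrM rmorphB rmorphXn /= !XE.
  exact: fc_scale.
have Xk i : X (i + k)%N = X i by rewrite /X iterD ek.
have pr29 : prime 29 by [].
have A29 : (polyA m n)%:~R = 0 :> 'F_29 by apply/eqP; rewrite -(dvdz_Fp _ pr29).
(* If 29 divided D = 2Q, it would divide Q and A, hence P. *)
have D29 : D%:~R != 0 :> 'F_29.
  apply/negP => /eqP D29; have Q29 : (cubQ m n)%:~R = 0 :> 'F_29.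
    have n2 : (2%:~R : 'F_29) != 0 by vm_compute.
    by move/eqP: D29; rewrite /D intrM mulf_eq0 (negPf n2) => /eqP.
  apply: (coprimez_cubP_cubQ co pr29) => //; apply/eqP.
  by move: A29; rewrite intr_polyA Q29 expr0n /= !mulr0 !addr0 => /eqP; rewrite expf_eq0.
have nofix : fc c x <> x.
  (* A fixed point gives D X = X^2 - A, that is (X - Q)^2 = A + Q^2. *)
  move=> fx; apply: (@no_square_A_plus_Q2 m n (X 0%N - cubQ m n)) => //.
  have X1 : X 1%N = X 0%N by rewrite /X /= fx.
  have := XS 0%N; rewrite X1 /D => e.
  rewrite (_ : polyA m n = X 0%N ^+ 2 - 2 * cubQ m n * X 0%N); last by rewrite e; ring.
  ring.
have [/X_inj e3|/dvdnP[q eq4]] := period3_or_dvd4 k0 A29 D29 XS Xk.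
  have k3 : (k <= 3)%N by rewrite leqNgt; apply/negP => /(mk 3 isT).
  case: k k3 k0 ek {mk ek_i Xk} => [|[|[|[|k]]]] // _ _ e2.
  (* Only k = 2 is left, and a point fixed by the second and third iterates is fixed by the map. *)
  by case: nofix; move: e3; rewrite [iter 3 _ _]/(fc c (iter 2 (fc c) x)) e2.
have q0 : (0 < q)%N by lia.
have X4 i : X (i + 4 * q)%N = X i by rewrite mulnC -eq4.
have ne2 : X (2 * q)%N != X 0%N.
  by apply/negP => /eqP /X_inj; apply: mk; lia.
by case: nB => nB; exfalso;
  [apply: (@period_not_4 7 2 m n X q) => //; [exact: sqr_neqN1_F7|exact: quad_orbit_check7]
  |apply: (@period_not_4 11 3 m n X q) => //; [exact: sqr_neqN1_F11|exact: quad_orbit_check11]].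
Qed.

Unset Implicit Arguments.

Theorem theorem13 (m n : int) :
  gcdz m n = 1 ->
  m * n * (m + n) != 0 ->
  (29 %| polyA m n)%Z ->
  (~~ (7 %| polyB m n)%Z \/ ~~ (11 %| polyB m n)%Z) ->
  let c : rat := - ((polyA m n)%:~R / (polyB m n)%:~R) in
  (forall (x : rat) (k : nat), min_period c x k -> k = 3%N) /\
  (exists x0 : rat, min_period c x0 3 /\
     forall x : rat, min_period c x 3 -> in_cycle c x0 3 x).
Proof.
move=> g1 Q0 dA nB c; have co : coprimez m n by apply/eqP.
have B0 : (polyB m n)%:~R != 0 :> rat.
  by rewrite intr_eq0 polyBE expf_eq0 /= mulf_eq0 negb_or.
have ec : (polyB m n)%:~R * c = - (polyA m n)%:~R.
  by rewrite /c mulrN mulrC divfK.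
split=> [x k|]; first exact: (@min_period_eq3 m n).
exists ((m%:~R ^+ 3 + 2 * m%:~R ^+ 2 * n%:~R + m%:~R * n%:~R ^+ 2 + n%:~R ^+ 3)
    / (2 * cubQ m%:~R n%:~R)); split; first exact: min_period3_start.
move=> x [_ [e3 h]]; apply: unique_cycle3 => //.
by apply/eqP; apply: (h 1%N).
Qed.
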